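(* Over $\mathbb{Q}[p_1,p_2,p_3,p_4]$, let $\mathcal{R}(x)=\sqrt{1+p_1x+p_2x^2+p_3x^3+p_4x^4}$. Then, as formal power series in $x,y$, one has the addition formula $$\int_0^x\frac{dt}{\mathcal{R}(t)}+\int_0^y\frac{dt}{\mathcal{R}(t)}=\int_0^{G(x,y)}\frac{dt}{\mathcal{R}(t)},$$ where $$G(x,y)=\mu\left(P_1+\sigma P_1+\frac12\nu(x)\nu(y)\frac{P_2-\sigma P_2}{P_3-\sigma P_3}\right),$$ $\sigma$ is the transposition of $x$ and $y$, and the series $P_i=P_i(x,y)$ are $$P_1=\nu(x)\mathcal{R}(y)\nu'(y),$$ $$P_2=-\nu(x)\Big(\nu'(y)\mathcal{R}(y)\big(\mathcal{R}'(y)-\mathcal{R}'(0)\big)+\mathcal{R}^2(y)\nu''(y)\Big),$$ $$P_3=\nu(x)\mathcal{R}(y)\nu'(y).$$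
   Context: $p_1,p_2,p_3,p_4$ are polynomial variables and the square root $\mathcal{R}$ has constant term $1$. The series $\mathcal{B}(x)\in\mathbb{Q}[p_1,p_2,p_3,p_4][[x]]$ is the unique formal power series with $\mathcal{B}(0)=1$ such that, with $\mu(x):=x/\mathcal{B}(x)$, one has $\mathcal{B}(x)=\mathcal{R}(\mu(x))/\mu'(x)$. The series $\mu(x)=x/\mathcal{B}(x)$ is thereby defined, and $\nu(x):=\mu^{-1}(x)$ is its compositional inverse. For a series $P(x,y)$, $(\sigma P)(x,y)=P(y,x)$. $\mathcal{R}^2(y)=(\mathcal{R}(y))^2$. *)

(* Defs.v *)
From HB Require Import structures.
From mathcomp Require Import all_boot all_order all_algebra.
From mathcomp Require Import boolp zify.
From mathcomp Require Import mpoly.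
Set Implicit Arguments.
Unset Strict Implicit.
Unset Printing Implicit Defensive.
Import GRing.Theory.
Local Open Scope ring_scope.

(* {fps A} = A[[x]], with f n the coefficient of x^n in f.
   {fps {fps A}} = A[[x, y]]: the outer variable is x and the inner one is y,
   so that F i j is the coefficient of x^i y^j. *)
Record fps (A : Type) := FPS { fps_coef :> nat -> A }.

Notation "{ 'fps' A }" := (fps A) (at level 0, A at level 100,
  format "{ 'fps'  A }") : type_scope.

HB.instance Definition _ (A : Type) := [isNew for @fps_coef A].
HB.instance Definition _ (A : choiceType) := [Choice of {fps A} by <:].

Section Zmodule.
Variable A : zmodType.
Implicit Types f g h : {fps A}.

Lemma fpsP f g : (forall n, f n = g n) -> f = g.
Proof. by case: f g => [f] [g] /= /funext ->. Qed.

Definition fps_zero : {fps A} := FPS (fun=> 0).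
Definition fps_opp f : {fps A} := FPS (fun n => - f n).
Definition fps_add f g : {fps A} := FPS (fun n => f n + g n).

Fact fps_addA : associative fps_add.
Proof. by move=> f g h; apply: fpsP => n; rewrite /= addrA. Qed.
Fact fps_addC : commutative fps_add.
Proof. by move=> f g; apply: fpsP => n; rewrite /= addrC. Qed.
Fact fps_add0 : left_id fps_zero fps_add.
Proof. by move=> f; apply: fpsP => n; rewrite /= add0r. Qed.
Fact fps_addN : left_inverse fps_zero fps_opp fps_add.
Proof. by move=> f; apply: fpsP => n; rewrite /= addNr. Qed.

HB.instance Definition _ :=
  GRing.isZmodule.Build {fps A} fps_addA fps_addC fps_add0 fps_addN.

Lemma fps0E n : (0 : {fps A}) n = 0. Proof. by []. Qed.
Lemma fpsNE f n : (- f) n = - f n. Proof. by []. Qed.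
Lemma fpsDE f g n : (f + g) n = f n + g n. Proof. by []. Qed.
Lemma fpsBE f g n : (f - g) n = f n - g n. Proof. by []. Qed.

Lemma fps_sumE I (r : seq I) (P : pred I) (F : I -> {fps A}) n :
  (\sum_(i <- r | P i) F i) n = \sum_(i <- r | P i) F i n.
Proof. by elim/big_rec2: _ => // i u f _ <-; rewrite fpsDE. Qed.

End Zmodule.

Section Ring.
Variable A : comNzRingType.
Implicit Types f g h : {fps A}.

Definition fpsC (a : A) : {fps A} := FPS (fun n => if n == 0%N then a else 0).

Definition fps_mul f g : {fps A} :=
  FPS (fun n => \sum_(i < n.+1) f i * g (n - i)%N).

Fact fps_mulC : commutative fps_mul.
Proof.
move=> f g; apply: fpsP => n; rewrite /= (reindex_inj rev_ord_inj) /=.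
apply: eq_bigr => i _; rewrite mulrC subSS subKn //; exact: ltn_ord i.
Qed.

Fact fps_mulA : associative fps_mul.
Proof.
move=> f g h; apply: fpsP => n.
pose coef3 i j := f i * (g (n - i - j)%N * h j).
transitivity (\sum_(i < n.+1) \sum_(j < n.+1 | (j <= n - i)%N) coef3 i j).
  apply: eq_bigr => /= i _.
  rewrite big_distrr /= (reindex_inj rev_ord_inj) /=.
  rewrite (big_ord_narrow_leq (leq_subr _ _)).
  apply: eq_bigr => j _; rewrite /coef3 /= subSS; congr (_ * (_ * h _)).
  by rewrite subKn // -ltnS.
rewrite /= (exchange_big_dep predT) //=.
rewrite (reindex_inj rev_ord_inj) /=; apply: eq_bigr => j _.
transitivity (\sum_(i < n.+1 | (i <= j)%N) coef3 i (n - j)%N).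
  apply: eq_big => [i | i _]; last by rewrite subSS.
  have jn : (j <= n)%N by rewrite -ltnS.
  have i_n : (i <= n)%N by rewrite -ltnS.
  by rewrite subSS; lia.
have jn : (j <= n)%N by rewrite -ltnS.
rewrite (big_ord_narrow_leq jn) big_distrl /=; apply: eq_bigr => i _.
by rewrite /coef3 mulrA /=; congr (_ * g _ * h _); lia.
Qed.

Fact fps_mul1 : left_id (fpsC 1) fps_mul.
Proof.
move=> f; apply: fpsP => n; rewrite /= big_ord_recl /= mul1r subn0.
by rewrite big1 ?addr0 // => i _; rewrite mul0r.
Qed.

Fact fps_mulD : left_distributive fps_mul (@fps_add A).
Proof.
move=> f g h; apply: fpsP => n; rewrite /= -big_split /=.
by apply: eq_bigr => i _; rewrite mulrDl.
Qed.

Fact fps_oner_neq0 : fpsC 1 != 0.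
Proof.
apply/eqP => /(congr1 (fun f : {fps A} => f 0%N)) /= /eqP.
by rewrite oner_eq0.
Qed.

HB.instance Definition _ := GRing.Zmodule_isComNzRing.Build {fps A}
  fps_mulA fps_mulC fps_mul1 fps_mulD fps_oner_neq0.

Lemma fps1E n : (1 : {fps A}) n = (n == 0%N)%:R.
Proof. by rewrite /=; case: eqP. Qed.
Lemma fpsME f g n : (f * g) n = \sum_(i < n.+1) f i * g (n - i)%N.
Proof. by []. Qed.
Lemma fpsM0 f g : (f * g) 0%N = f 0%N * g 0%N.
Proof. by rewrite fpsME big_ord1. Qed.

Lemma fpsX_lt f k n : f 0%N = 0 -> (n < k)%N -> (f ^+ k) n = 0.
Proof.
move=> f0; elim: k n => // k IHk n lt_nk.
rewrite exprS fpsME big_ord_recl f0 mul0r add0r big1 // => i _.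
rewrite IHk ?mulr0 //= /bump leq0n; case: n lt_nk i => [|n] lt_nk; first by case.
by move=> i; rewrite subSS (leq_ltn_trans (leq_subr _ _)).
Qed.

End Ring.

Section UnitRing.
Variable A : comUnitRingType.
Implicit Types f g : {fps A}.

Definition fps_unit : pred {fps A} := fun f => f 0%N \is a GRing.unit.

(* geometric series for 1 / (1 - u) when u 0 = 0 *)
Definition fps_geom (u : {fps A}) : {fps A} :=
  FPS (fun n => \sum_(k < n.+1) (u ^+ k) n).

Definition fps_inv f : {fps A} :=
  if f 0%N \is a GRing.unit
  then fpsC (f 0%N)^-1 * fps_geom (1 - fpsC (f 0%N)^-1 * f) else f.

Lemma fps_geomP (u : {fps A}) : u 0%N = 0 -> (1 - u) * fps_geom u = 1.
Proof.
move=> u0; apply: fpsP => n.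
have trunc m : (m <= n)%N -> fps_geom u m = (\sum_(k < n.+1) u ^+ k) m.
  move=> le_mn; rewrite fps_sumE /= -(subnKC le_mn) -addSn big_split_ord /=.
  rewrite [X in _ + X]big1 ?addr0 // => i _.
  by rewrite fpsX_lt // leq_addr.
have -> : ((1 - u) * fps_geom u) n = ((1 - u) * \sum_(k < n.+1) u ^+ k) n.
  by rewrite !fpsME; apply: eq_bigr => i _; rewrite trunc // leq_subr.
by rewrite -opprB mulNr -subrX1 opprB fpsBE fpsX_lt // subr0.
Qed.

Fact fps_mulVr : {in fps_unit, left_inverse 1 fps_inv *%R}.
Proof.
move=> f; rewrite unfold_in /fps_unit /fps_inv => uf; rewrite uf.
set c := fpsC _; rewrite -mulrA [_ * f]mulrC mulrA.
set u := 1 - _; have -> : c * f = 1 - u by rewrite subKr.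
by rewrite fps_geomP // fpsBE fps1E fpsM0 /= mulVr ?subrr.
Qed.

Fact fps_unitPl f g : g * f = 1 -> fps_unit f.
Proof.
move/(congr1 (fun h : {fps A} => h 0%N)); rewrite fpsM0 fps1E /= => gf.
by apply/unitrPr; exists (g 0%N); rewrite mulrC.
Qed.

Fact fps_invr_out : {in [predC fps_unit], fps_inv =1 id}.
Proof. by move=> f; rewrite !inE /fps_inv => /negPf; rewrite unfold_in /fps_unit => ->. Qed.

HB.instance Definition _ := GRing.ComNzRing_hasMulInverse.Build {fps A}
  fps_mulVr fps_unitPl fps_invr_out.

End UnitRing.

Section Calculus.
Variable A : comUnitRingType.
Implicit Types f g : {fps A}.

Definition fpsX : {fps A} := FPS (fun n => (n == 1%N)%:R).

Definition fps_deriv f : {fps A} := FPS (fun n => f n.+1 *+ n.+1).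

(* int_0^x f(t) dt; meaningful when the positive integers are units of A *)
Definition fps_int f : {fps A} :=
  FPS (fun n => if n is m.+1 then f m / m.+1%:R else 0).

(* f(g(x)), for g 0 = 0: then g ^+ k has no term of degree n < k *)
Definition fps_comp f g : {fps A} :=
  FPS (fun n => \sum_(k < n.+1) f k * (g ^+ k) n).

(* f(G(x, y)), for G 0 0 = 0: then G ^+ k has no term of total degree < k *)
Definition fps_comp2 f (G : {fps {fps A}}) : {fps {fps A}} :=
  FPS (fun i => FPS (fun j => \sum_(k < (i + j).+1) f k * (G ^+ k) i j)).

Definition in_x f : {fps {fps A}} := FPS (fun i => fpsC (f i)).
Definition in_y f : {fps {fps A}} := fpsC f.

Definition swap (F : {fps {fps A}}) : {fps {fps A}} :=
  FPS (fun i => FPS (fun j => F j i)).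

Definition comp_inverse f g : Prop :=
  [/\ f 0%N = 0, g 0%N = 0, fps_comp f g = fpsX & fps_comp g f = fpsX].

End Calculus.

Arguments fpsX {A}.

(* the ring Q[p_1, p_2, p_3, p_4], with p_(i+1) = 'X_i *)
Notation Qp := {mpoly rat[4]}.

Definition quartic : {fps Qp} :=
  1 + \sum_(i < 4) fpsC ('X_i : Qp) * fpsX ^+ i.+1.

Definition is_sqrt_quartic (R : {fps Qp}) : Prop :=
  R 0%N = 1 /\ R ^+ 2 = quartic.

Definition mu_of (B : {fps Qp}) : {fps Qp} := fpsX / B.

Definition is_calB (R B : {fps Qp}) : Prop :=
  B 0%N = 1 /\ B = fps_comp R (mu_of B) / fps_deriv (mu_of B).

Definition P1 (R nu : {fps Qp}) : {fps {fps Qp}} :=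
  in_x nu * in_y R * in_y (fps_deriv nu).

Definition P2 (R nu : {fps Qp}) : {fps {fps Qp}} :=
  - in_x nu *
    (in_y (fps_deriv nu) * in_y R *
       (in_y (fps_deriv R) - in_y (fpsC (fps_deriv R 0%N)))
     + in_y R ^+ 2 * in_y (fps_deriv (fps_deriv nu))).

Definition P3 (R nu : {fps Qp}) : {fps {fps Qp}} :=
  in_x nu * in_y R * in_y (fps_deriv nu).

(* P3 - swap P3 has no constant term, so it is not a unit of Qp[[x, y]]: the
   quotient (P2 - swap P2) / (P3 - swap P3) is an exact one. *)
Definition is_quotient (R nu : {fps Qp}) (Q : {fps {fps Qp}}) : Prop :=
  Q * (P3 R nu - swap (P3 R nu)) = P2 R nu - swap (P2 R nu).

Definition G_of (R mu nu : {fps Qp}) (Q : {fps {fps Qp}}) : {fps {fps Qp}} :=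
  fps_comp2 mu (P1 R nu + swap (P1 R nu) + 2^-1 * in_x nu * in_y nu * Q).

(* Main.v *)
From HB Require Import structures.
Require Import Defs.
From mathcomp Require Import all_boot all_order all_algebra.
From mathcomp Require Import boolp.
From mathcomp Require Import mpoly.
From mathcomp Require Import ring zify.
Import GRing.Theory.
Local Open Scope ring_scope.

(* The functional equation for B says x mu' = mu R(mu), that is nu = x R nu'.
   With v = nu / x = R nu' the argument of mu in G is
     W = v(x) v(y) (x^2 - y^2 + x^2 R(y) - y^2 R(x) + R'(0) x y (x - y))
         / (2 (x - y)),
   and R^2 = 1 + p_1 x + ... + p_4 x^4 gives D W = 0 for the derivation
   D = R(x) d/dx - R(y) d/dy.  By the chain rule D kills both sides of the addition
   formula, which agree at x = 0 because W(0, y) = nu(y); and a series killed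
   by D is determined by its restriction to x = 0. *)

(** * Derivations on a commutative ring *)

Section Derivation.
Context {S : comNzRingType} (d : {additive S -> S}).
Hypothesis dM : forall f g, d (f * g) = d f * g + f * d g.

Lemma derivationX f k : d (f ^+ k.+1) = f ^+ k * d f *+ k.+1.
Proof.
elim: k => [|k IHk]; first by rewrite mul1r.
by rewrite exprS dM IHk mulrnAr mulrA -exprS [d f * _]mulrC -mulrS.
Qed.

(** Applied to truncated compositions, this yields the chain rule for [fps_comp] and, with d/dx and
    d/dy, for [fps_comp2]. *)
Lemma derivation_sum (c : nat -> S) g N : (forall k, d (c k) = 0) ->
  d (\sum_(k < N.+1) c k * g ^+ k) =
  (\sum_(k < N) c k.+1 *+ k.+1 * g ^+ k) * d g.
Proof.
move=> dc; rewrite raddf_sum big_ord_recl mulr1 dc add0r mulr_suml.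
apply: eq_bigr => k _.
by rewrite dM dc mul0r add0r derivationX mulrnAr !mulrnAl mulrA.
Qed.

End Derivation.

(** * Constant series and constant terms as ring morphisms *)

Section Constants.
Context {A : comNzRingType}.
Implicit Types f g : {fps A}.

Lemma fpsCME (a : A) f n : (fpsC a * f) n = a * f n.
Proof.
rewrite fpsME big_ord_recl /= subn0 big1 ?addr0 // => i _.
by rewrite mul0r.
Qed.

Fact fpsC_is_additive : zmod_morphism (@fpsC A).
Proof. by move=> a b; apply: fpsP => -[|n]; rewrite fpsBE //= subr0. Qed.
HB.instance Definition _ :=
  GRing.isZmodMorphism.Build A {fps A} (@fpsC A) fpsC_is_additive.

Fact fpsC_is_monoid_morphism : monoid_morphism (@fpsC A).
Proof.
split=> // a b; apply: fpsP => n; rewrite fpsCME /=.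
by case: eqP => _; rewrite ?mulr0.
Qed.
HB.instance Definition _ :=
  GRing.isMonoidMorphism.Build A {fps A} (@fpsC A) fpsC_is_monoid_morphism.

Definition fps_head f : A := f 0%N.

Fact fps_head_is_additive : zmod_morphism fps_head.
Proof. by []. Qed.
HB.instance Definition _ :=
  GRing.isZmodMorphism.Build {fps A} A fps_head fps_head_is_additive.

Fact fps_head_is_monoid_morphism : monoid_morphism fps_head.
Proof. by split=> // f g; rewrite /fps_head fpsM0. Qed.
HB.instance Definition _ :=
  GRing.isMonoidMorphism.Build {fps A} A fps_head fps_head_is_monoid_morphism.

(** Allows a composition inside a product to be replaced by a truncation of it. *)
Lemma fpsM_eq f g h n : (forall m, (m <= n)%N -> f m = g m) ->
  (f * h) n = (g * h) n.
Proof.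
by move=> fg; rewrite !fpsME; apply: eq_bigr => i _; rewrite fg // -ltnS.
Qed.

Lemma fpsMnE f m n : (f *+ m) n = f n *+ m.
Proof. by elim: m => // m IHm; rewrite !mulrS fpsDE IHm. Qed.

End Constants.

(** * Derivation and composition of series in one variable *)

Section OneVariable.
Context {A : comUnitRingType}.
Implicit Types f g h : {fps A}.

Lemma fpsXM_S f n : (fpsX * f) n.+1 = f n.
Proof.
rewrite fpsME !big_ord_recl /= mul0r add0r mul1r subSS subn0 big1 ?addr0 //.
by move=> i _; rewrite mul0r.
Qed.

Lemma fpsXI f g : fpsX * f = fpsX * g -> f = g.
Proof. by move=> fg; apply: fpsP => n; rewrite -fpsXM_S fg fpsXM_S. Qed.

Fact fps_deriv_is_additive : zmod_morphism (@fps_deriv A).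
Proof. by move=> f g; apply: fpsP => n; rewrite fpsBE /= mulrnBl. Qed.
HB.instance Definition _ := GRing.isZmodMorphism.Build {fps A} {fps A}
  (@fps_deriv A) fps_deriv_is_additive.

Lemma fps_derivE f n : fps_deriv f n = f n.+1 *+ n.+1. Proof. by []. Qed.

Lemma fps_derivM f g : fps_deriv (f * g) = fps_deriv f * g + f * fps_deriv g.
Proof.
apply: fpsP => n; rewrite fps_derivE fpsDE !fpsME -sumrMnl.
have split_term (i : 'I_n.+2) : f i * g (n.+1 - i)%N *+ n.+1 =
    (f i *+ i) * g (n.+1 - i)%N + f i * (g (n.+1 - i)%N *+ (n.+1 - i)%N).
  by rewrite mulrnAl mulrnAr -mulrnDr subnKC // -ltnS.
rewrite (eq_bigr _ (fun i _ => split_term i)) big_split /=; congr (_ + _).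
  by rewrite big_ord_recl /= mulr0n mul0r add0r.
rewrite big_ord_recr /= subnn mulr0n mulr0 addr0; apply: eq_bigr => i _.
by rewrite subSn // -ltnS.
Qed.

Lemma fps_derivC (a : A) : fps_deriv (fpsC a) = 0.
Proof. by apply: fpsP => n; rewrite fps_derivE mul0rn. Qed.

Lemma fps_derivX : fps_deriv (@fpsX A) = 1.
Proof. by apply: fpsP => -[|n]; rewrite fps_derivE fps1E //= mul0rn. Qed.

Lemma fps_deriv_int f : (forall n, n.+1%:R \is a @GRing.unit A) ->
  fps_deriv (fps_int f) = f.
Proof.
by move=> unitS; apply: fpsP => n; rewrite fps_derivE -[LHS]mulr_natr divrK.
Qed.

(** The powers [g ^+ k] with [k > n] do not reach degree [n]. A bound [N] common to several
    coefficients makes the composite a finite sum in the ring, to which ring laws and derivations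
    apply. *)
Lemma fps_comp_trunc f g N n : g 0%N = 0 -> (n < N)%N ->
  fps_comp f g n = (\sum_(k < N) fpsC (f k) * g ^+ k) n.
Proof.
move=> g0 ltnN; rewrite fps_sumE [LHS]/= (big_ord_widen N (fun k => f k * (g ^+ k) n)) //.
rewrite big_mkcond; apply: eq_bigr => k _; rewrite fpsCME.
by case: ltnP => // ltnk; rewrite fpsX_lt ?mulr0.
Qed.

Lemma fps_comp0 f g : fps_comp f g 0%N = f 0%N.
Proof. by rewrite /= big_ord1 mulr1. Qed.

Lemma fps_compX f : fps_comp f fpsX = f.
Proof.
have X_pow k n : (fpsX ^+ k : {fps A}) n = (n == k)%:R.
  elim: k n => [|k IHk] n; first by rewrite fps1E.
  by rewrite exprS; case: n => [|n]; rewrite ?fpsM0 ?mul0r // fpsXM_S IHk.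
apply: fpsP => n; rewrite /= big_ord_recr /= X_pow eqxx mulr1 big1 ?add0r // => k _.
by rewrite X_pow gtn_eqF ?mulr0.
Qed.

Lemma fpsX_comp g : g 0%N = 0 -> fps_comp fpsX g = g.
Proof.
move=> g0; apply: fpsP => n.
rewrite (fps_comp_trunc _ _ n.+2) // !big_ord_recl big1 ?addr0.
  by rewrite [fpsX _]/= rmorph0 mul0r add0r [fpsX _]/= rmorph1 mul1r expr1.
by move=> i _; rewrite [fpsX _]/= rmorph0 mul0r.
Qed.

Lemma fps_compM f g h : h 0%N = 0 ->
  fps_comp (f * g) h = fps_comp f h * fps_comp g h.
Proof.
move=> h0; apply: fpsP => n.
transitivity (((\sum_(k < n.+1) fpsC (f k) * h ^+ k) *
               (\sum_(k < n.+1) fpsC (g k) * h ^+ k)) n); last first.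
  rewrite [RHS](fpsM_eq _ (\sum_(k < n.+1) fpsC (f k) * h ^+ k)); last first.
    by move=> m lemn; rewrite (fps_comp_trunc _ _ n.+1).
  rewrite mulrC [in RHS]mulrC; apply: fpsM_eq => m lemn.
  by rewrite (fps_comp_trunc _ _ n.+1).
rewrite big_distrlr fps_sumE.
(* The double sum is regrouped by [k = i + j]; the pairs with [i + j > n] drop out because
   [h ^+ (i + j)] has no term of degree [n]. *)
transitivity (\sum_(i < n.+1) \sum_(k < n.+1 | (i <= k)%N)
                f i * g (k - i)%N * (h ^+ k) n); last first.
  apply: eq_bigr => i _; rewrite fps_sumE; symmetry.
  have term (j : 'I_n.+1) : (fpsC (f i) * h ^+ i * (fpsC (g j) * h ^+ j)) n =
      f i * g j * (h ^+ (i + j)) n.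
    by rewrite mulrACA -exprD -rmorphM fpsCME.
  rewrite (eq_bigr _ (fun j _ => term j)).
  rewrite -(big_mkord xpredT (fun j => f i * g j * (h ^+ (i + j)) n)).
  rewrite -(big_mkord (fun k => (i <= k)%N)
              (fun k => f i * g (k - i)%N * (h ^+ k) n)).
  have lein : (i <= n.+1)%N by apply: ltnW.
  rewrite [RHS](big_cat_nat (n := i)) //= [X in _ = X + _]big_nat_cond.
  rewrite [X in _ = X + _]big1 ?add0r; last by move=> k; lia.
  rewrite -{1}[i : nat in RHS]add0n.
  rewrite big_addn [RHS]big_mkcond /=.
  rewrite [LHS](big_cat_nat (n := n.+1 - i)%N) ?leq_subr //=.
  rewrite [X in _ + X]big_nat_cond [X in _ + X]big1 ?addr0; last first.
    by move=> j /andP[/andP[lej _] _]; rewrite fpsX_lt ?mulr0 //; lia.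
  by apply: eq_bigr => j _; rewrite leq_addl addnK addnC.
rewrite [RHS](exchange_big_dep predT) //; apply: eq_bigr => k _.
rewrite fpsME mulr_suml.
rewrite -(big_mkord (fun i => (i <= k)%N)
            (fun i => f i * g (k - i)%N * (h ^+ k) n)).
rewrite (big_cat_nat (n := k.+1)) //= [X in _ = _ + X]big_nat_cond.
rewrite [X in _ + X]big1 ?addr0; last by move=> i; lia.
by rewrite big_mkord [RHS]big_mkcond; apply: eq_bigr => i _; rewrite -ltnS ltn_ord.
Qed.

Lemma fps_comp1 g : fps_comp 1 g = 1.
Proof.
apply: fpsP => n; rewrite /= big_ord_recl /= mul1r big1 ?addr0 // => k _.
by rewrite mul0r.
Qed.

Lemma fps_comp_exp f g k : g 0%N = 0 -> fps_comp (f ^+ k) g = fps_comp f g ^+ k.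
Proof.
by move=> g0; elim: k => [|k IHk]; rewrite ?fps_comp1 // !exprS fps_compM ?IHk.
Qed.

(** One bound [n.+1] serves all inner truncations, so the two sums can be exchanged; [fps_comp_exp]
    then recognizes the powers of [fps_comp g h]. *)
Lemma fps_compA f g h : g 0%N = 0 -> h 0%N = 0 ->
  fps_comp (fps_comp f g) h = fps_comp f (fps_comp g h).
Proof.
move=> g0 h0; apply: fpsP => n.
transitivity (\sum_(k < n.+1) \sum_(j < n.+1) f j * (g ^+ j) k * (h ^+ k) n).
  apply: eq_bigr => k _; rewrite (fps_comp_trunc _ _ n.+1) // fps_sumE mulr_suml.
  by apply: eq_bigr => j _; rewrite fpsCME.
rewrite exchange_big; apply: eq_bigr => j _ /=.
rewrite -fps_comp_exp // mulr_sumr.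
by apply: eq_bigr => k _; rewrite mulrA.
Qed.

Lemma fps_deriv_comp f g : g 0%N = 0 ->
  fps_deriv (fps_comp f g) = fps_comp (fps_deriv f) g * fps_deriv g.
Proof.
move=> g0; apply: fpsP => n.
(* The bound is [n.+2] because coefficient [n] of the derivative reads coefficient [n.+1] of the
   composite. *)
rewrite fps_derivE (fps_comp_trunc _ _ n.+2) // -fps_derivE.
rewrite (derivation_sum _ fps_derivM (fun k => fpsC (f k))); last first.
  by move=> k; apply: fps_derivC.
apply: fpsM_eq => m lemn; rewrite (fps_comp_trunc _ _ n.+1) //.
by rewrite !fps_sumE; apply: eq_bigr => k _; rewrite fps_derivE raddfMn.
Qed.

End OneVariable.

(** * Series in two variables, division by x - y, and the derivation D *)

Section TwoVariables.
Context {A : comUnitRingType}.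
Implicit Types (f g : {fps A}) (F G H : {fps {fps A}}).

Lemma fps2P F G : (forall i j, F i j = G i j) -> F = G.
Proof. by move=> FG; apply: fpsP => i; apply: fpsP => j. Qed.

Fact in_x_is_additive : zmod_morphism (@in_x A).
Proof. by move=> f g; apply: fpsP => i; rewrite fpsBE /= rmorphB. Qed.
HB.instance Definition _ := GRing.isZmodMorphism.Build {fps A} {fps {fps A}}
  (@in_x A) in_x_is_additive.

Fact in_x_is_monoid_morphism : monoid_morphism (@in_x A).
Proof.
split=> [|f g]; apply: fpsP => i.
  by rewrite fps1E [LHS]/=; case: i => [|i]; rewrite ?rmorph1 ?rmorph0.
rewrite fpsME [LHS]/= rmorph_sum; apply: eq_bigr => k _.
by rewrite rmorphM.
Qed.
HB.instance Definition _ := GRing.isMonoidMorphism.Build {fps A} {fps {fps A}}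
  (@in_x A) in_x_is_monoid_morphism.

HB.instance Definition _ := GRing.RMorphism.copy (@in_y A) (@fpsC {fps A}).

Fact swap_is_additive : zmod_morphism (@swap A).
Proof. by move=> F G; apply: fps2P => i j. Qed.
HB.instance Definition _ := GRing.isZmodMorphism.Build
  {fps {fps A}} {fps {fps A}} (@swap A) swap_is_additive.

Lemma fps2ME F G i j :
  (F * G) i j =
  \sum_(a < i.+1) \sum_(b < j.+1) F a b * G (i - a)%N (j - b)%N.
Proof. by rewrite fpsME fps_sumE. Qed.

Fact swap_is_monoid_morphism : monoid_morphism (@swap A).
Proof.
split=> [|F G]; apply: fps2P => i j; first by case: i j => [|i] [|j].
by rewrite fps2ME [LHS]fps2ME exchange_big.
Qed.
HB.instance Definition _ := GRing.isMonoidMorphism.Build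
  {fps {fps A}} {fps {fps A}} (@swap A) swap_is_monoid_morphism.

Lemma swap_in_x f : swap (in_x f) = in_y f.
Proof. by apply: fps2P => -[|i] [|j]. Qed.

Lemma swap_in_y f : swap (in_y f) = in_x f.
Proof. by apply: fps2P => -[|i] [|j]. Qed.

Lemma in_xV f : f 0%N \is a GRing.unit -> in_x f^-1 = (in_x f)^-1.
Proof. exact: (rmorphV (@in_x A)). Qed.

Lemma in_x_fpsX : in_x (@fpsX A) = fpsX.
Proof.
by apply: fpsP => i; rewrite /=; case: eqP => _; rewrite ?rmorph1 ?rmorph0.
Qed.

Lemma in_xXM_I F G : in_x fpsX * F = in_x fpsX * G -> F = G.
Proof. by rewrite in_x_fpsX; apply: fpsXI. Qed.

Lemma swapK : involutive (@swap A).
Proof. by move=> F; apply: fps2P. Qed.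

Lemma in_yXM_I F G : in_y fpsX * F = in_y fpsX * G -> F = G.
Proof.
move=> /(congr1 (@swap A)); rewrite !rmorphM /= !swap_in_y => /in_xXM_I.
exact: (can_inj swapK).
Qed.

Lemma subXYM_coef F i j :
  (F * (in_x fpsX - in_y fpsX)) i j =
    (if i is i'.+1 then F i' j else 0) - (if j is j'.+1 then F i j' else 0).
Proof.
rewrite mulrBr !fpsBE in_x_fpsX ![F * _]mulrC; congr (_ - _).
  by case: i => [|i]; rewrite ?fpsXM_S // fpsM0 mul0r.
by rewrite /in_y fpsCME; case: j => [|j]; rewrite ?fpsXM_S // fpsM0 mul0r.
Qed.

(** Although x - y is not a unit, it can be cancelled: if E (x - y) = 0, its coefficient at (i, j+1)
    gives E(i, j) = E(i-1, j+1), or 0 when i = 0, so the rows of E vanish one after another. *)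
Lemma subXYM_I F G :
  F * (in_x fpsX - in_y fpsX) = G * (in_x fpsX - in_y fpsX) -> F = G.
Proof.
move=> /eqP; rewrite -subr_eq0 -mulrBl => /eqP; move: (F - G) (subrK G F).
move=> E <- E0; suff -> : E = 0 by rewrite add0r.
apply: fpsP; elim=> [|i IHi]; apply: fpsP => j.
  have /esym := subXYM_coef E 0 j.+1.
  by rewrite E0 sub0r => /eqP; rewrite oppr_eq0 => /eqP.
have /esym := subXYM_coef E i.+1 j.+1.
by rewrite E0 IHi sub0r => /eqP; rewrite oppr_eq0 => /eqP.
Qed.

(** The difference vanishes on the diagonal x = y: its coefficients sum to zero along each
    antidiagonal, which is the only obstruction to dividing by x - y. *)
Lemma sub_swap_divisible F :
  exists Q, Q * (in_x fpsX - in_y fpsX) = F - swap F.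
Proof.
pose D := F - swap F.
have D_diag n : \sum_(k < n.+1) D k (n - k)%N = 0.
  rewrite (eq_bigr (fun k : 'I_n.+1 => F k (n - k)%N - F (n - k)%N k)) //.
  rewrite sumrB [X in _ - X](reindex_inj rev_ord_inj) /=; apply/eqP.
  rewrite subr_eq0; apply/eqP/eq_bigr => k _.
  by rewrite subSS subKn // -ltnS.
(* The witness solves the recurrence Q(i, j) = Q(i-1, j+1) - D(i, j+1) given by [subXYM_coef]. The
   remaining equations, those in column j = 0, are instances of [D_diag]. *)
exists (FPS (fun i => FPS (fun j => - \sum_(k < i.+1) D k (i + j.+1 - k)%N))).
rewrite -/D; apply: fps2P => i j; rewrite subXYM_coef.
case: i j => [|i] [|j].
- by have := D_diag 0%N; rewrite big_ord1 subr0 => ->.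
- by rewrite /= big_ord1 sub0r opprK.
- have := D_diag i.+1; rewrite big_ord_recr /= subnn addn1 subr0 => /eqP.
  by rewrite addrC addr_eq0 => /eqP.
rewrite /= [X in _ - - X]big_ord_recr /= addnS opprK addrA addSn.
by rewrite addnS addNr add0r; congr (D i.+1 _); lia.
Qed.

(** The outer variable being x, [fps_deriv] itself is d/dx on [{fps {fps A}}], and d/dy acts on each
    coefficient. *)
Definition dy F : {fps {fps A}} := FPS (fun i => fps_deriv (F i)).

Fact dy_is_additive : zmod_morphism dy.
Proof. by move=> F G; apply: fpsP => i; apply: (raddfB (@fps_deriv A)). Qed.
HB.instance Definition _ := GRing.isZmodMorphism.Build
  {fps {fps A}} {fps {fps A}} dy dy_is_additive.

Lemma dyM F G : dy (F * G) = dy F * G + F * dy G.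
Proof.
apply: fpsP => i; rewrite fpsDE !fpsME [LHS]/= raddf_sum -big_split.
by apply: eq_bigr => k _; apply: fps_derivM.
Qed.

Lemma dx_in_x f : fps_deriv (in_x f) = in_x (fps_deriv f).
Proof. by apply: fpsP => i; rewrite /= raddfMn. Qed.

Lemma dx_in_y f : fps_deriv (in_y f) = 0.
Proof. exact: fps_derivC. Qed.

Lemma dy_in_x f : dy (in_x f) = 0.
Proof. by apply: fpsP => i; apply: fps_derivC. Qed.

Lemma dy_in_y f : dy (in_y f) = in_y (fps_deriv f).
Proof. by apply: fpsP => -[|i] //; apply: (raddf0 (@fps_deriv A)). Qed.

Lemma fps2X_lt F k i j : F 0%N 0%N = 0 -> (i + j < k)%N -> (F ^+ k) i j = 0.
Proof.
move=> F0; elim: k i j => // k IHk i j lt_k.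
rewrite exprS fps2ME big1 // => a _; rewrite big1 // => b _.
have [ab0 | ab_gt0] := posnP (a + b)%N; last first.
  by rewrite IHk ?mulr0 //; have := ltn_ord a; have := ltn_ord b; lia.
have [-> ->] : nat_of_ord a = 0%N /\ nat_of_ord b = 0%N by split; lia.
by rewrite F0 mul0r.
Qed.

Lemma fps_comp2_trunc f G N i j : G 0%N 0%N = 0 -> (i + j < N)%N ->
  fps_comp2 f G i j = (\sum_(k < N) fpsC (fpsC (f k)) * G ^+ k) i j.
Proof.
move=> G0 ltN; rewrite !fps_sumE [LHS]/=.
rewrite (big_ord_widen N (fun k => f k * (G ^+ k) i j)) //.
rewrite big_mkcond; apply: eq_bigr => k _; rewrite !fpsCME.
by case: ltnP => // ltk; rewrite fps2X_lt ?mulr0.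
Qed.

Lemma fps2M_eq F G H i j :
  (forall a b, (a <= i)%N -> (b <= j)%N -> F a b = G a b) ->
  (F * H) i j = (G * H) i j.
Proof.
move=> FG; rewrite !fps2ME; apply: eq_bigr => a _; apply: eq_bigr => b _.
by rewrite FG // -ltnS.
Qed.

Lemma dx_comp2 f G : G 0%N 0%N = 0 ->
  fps_deriv (fps_comp2 f G) = fps_comp2 (fps_deriv f) G * fps_deriv G.
Proof.
move=> G0; apply: fps2P => i j; pose N := (i + j).+1.
rewrite fps_derivE fpsMnE (fps_comp2_trunc _ _ N.+1) // -fpsMnE -fps_derivE.
rewrite (derivation_sum _ fps_derivM (fun k => fpsC (fpsC (f k)))); last first.
  by move=> k; apply: fps_derivC.
apply: fps2M_eq => a b leai lebj; rewrite (fps_comp2_trunc _ _ N) //; last first.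
  by rewrite ltnS leq_add.
by rewrite !fps_sumE; apply: eq_bigr => k _; rewrite fps_derivE !raddfMn.
Qed.

Lemma dy_comp2 f G : G 0%N 0%N = 0 ->
  dy (fps_comp2 f G) = fps_comp2 (fps_deriv f) G * dy G.
Proof.
move=> G0; apply: fps2P => i j; pose N := (i + j).+1.
rewrite [LHS]fps_derivE (fps_comp2_trunc _ _ N.+1) ?addnS //.
rewrite -[LHS]/(dy _ i j).
rewrite (derivation_sum _ dyM (fun k => fpsC (fpsC (f k)))); last first.
  by move=> k; rewrite -[fpsC (fpsC _)]/(in_y _) [LHS]dy_in_y fps_derivC rmorph0.
apply: fps2M_eq => a b leai lebj; rewrite (fps_comp2_trunc _ _ N) //; last first.
  by rewrite ltnS leq_add.
by rewrite !fps_sumE; apply: eq_bigr => k _; rewrite fps_derivE !raddfMn.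
Qed.

(** Setting x = 0 is the ring morphism [fps_head], hence commutes with powers of [G]. *)
Lemma fps_comp2_x0 f G : fps_comp2 f G 0%N = fps_comp f (G 0%N).
Proof.
apply: fpsP => j; apply: eq_bigr => k _; congr (_ * _).
by rewrite -[G 0%N]/(fps_head G) -rmorphXn.
Qed.

(** For [f = R] this is D, the vector field along which the sum of the integrals of dx/R(x) and
    dy/R(y) is constant. *)
Definition elliptic_deriv f F := in_x f * fps_deriv F - in_y f * dy F.

Fact elliptic_deriv_is_additive f : zmod_morphism (elliptic_deriv f).
Proof. by move=> F G; rewrite /elliptic_deriv !raddfB /= !mulrBr; ring. Qed.
HB.instance Definition _ f := GRing.isZmodMorphism.Build
  {fps {fps A}} {fps {fps A}} (elliptic_deriv f) (elliptic_deriv_is_additive f).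

Lemma elliptic_derivM f F G : elliptic_deriv f (F * G) =
  elliptic_deriv f F * G + F * elliptic_deriv f G.
Proof. by rewrite /elliptic_deriv fps_derivM dyM; ring. Qed.

Lemma elliptic_deriv_in_x f g :
  elliptic_deriv f (in_x g) = in_x (f * fps_deriv g).
Proof. by rewrite /elliptic_deriv dx_in_x dy_in_x mulr0 subr0 rmorphM. Qed.

Lemma elliptic_deriv_in_y f g :
  elliptic_deriv f (in_y g) = - in_y (f * fps_deriv g).
Proof. by rewrite /elliptic_deriv dx_in_y dy_in_y mulr0 sub0r rmorphM. Qed.

Lemma elliptic_deriv_comp2 f g G : G 0%N 0%N = 0 ->
  elliptic_deriv f (fps_comp2 g G) =
  fps_comp2 (fps_deriv g) G * elliptic_deriv f G.
Proof. by move=> G0; rewrite /elliptic_deriv dx_comp2 // dy_comp2 //; ring. Qed.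

(* The equation D F = 0 determines d/dx F from d/dy F, hence the slices
   [F n] in turn from [F 0]. *)
Lemma elliptic_deriv_inj0 f F :
  (forall n, n.+1%:R \is a @GRing.unit A) -> f 0%N \is a GRing.unit ->
  elliptic_deriv f F = 0 -> F 0%N = 0 -> F = 0.
Proof.
move=> unitS unitf /subr0_eq DF F0.
have {}DF : fps_deriv F = dy F * in_y f * in_x f^-1.
  by rewrite [_ * in_y f]mulrC -DF in_xV // mulrC mulKr // rmorph_unit.
suff F_lt n m : (m <= n)%N -> F m = 0 by apply: fpsP => n; apply: (F_lt n).
elim: n m => [|n IHn] m; first by rewrite leqn0 => /eqP ->.
rewrite leq_eqVlt ltnS => /predU1P[-> | /IHn //].
have : fps_deriv F n = 0.
  rewrite DF -mulrA (fpsM_eq _ 0) ?mul0r // => k lekn.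
  by rewrite [LHS]/= IHn // raddf0.
rewrite fps_derivE => Fn; apply: fpsP => j.
move: (congr1 (fun h : {fps A} => h j) Fn); rewrite fpsMnE -mulr_natr.
by move=> /(congr1 ( *%R^~ n.+1%:R^-1)); rewrite /= mulrK // mul0r.
Qed.

End TwoVariables.

(* [a], [b], [a'], [b'] stand for [R(x)], [R(y)], [R'(x)], [R'(y)], and [vx], [vy]
   for [nu(x)/x], [nu(y)/y]. *)
Lemma elliptic_invariant {S : comNzRingType} (D : {additive S -> S})
    (x y a b a' b' vx vy r p2 p3 p4 W : S) :
  (forall f g, D (f * g) = D f * g + f * D g) ->
  a * a = 1 + 2 * r * x + p2 * x ^+ 2 + p3 * x ^+ 3 + p4 * x ^+ 4 ->
  b * b = 1 + 2 * r * y + p2 * y ^+ 2 + p3 * y ^+ 3 + p4 * y ^+ 4 ->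
  2 * a * a' = 2 * r + 2 * p2 * x + 3 * p3 * x ^+ 2 + 4 * p4 * x ^+ 3 ->
  2 * b * b' = 2 * r + 2 * p2 * y + 3 * p3 * y ^+ 2 + 4 * p4 * y ^+ 3 ->
  D x = a -> D y = - b -> D a = a * a' -> D b = - (b * b') -> D r = 0 ->
  x * D vx = vx * (1 - a) -> y * D vy = - (vy * (1 - b)) ->
  2 * ((x - y) * W) = vx * vy *
    (x * x - y * y + x * x * b - y * y * a + r * (x * y * (x - y))) ->
  4 * (x * (y * ((x - y) * ((x - y) * D W)))) = 0.
Proof.
move=> DM a2 b2 aa' bb' Dx Dy Da Db Dr Dvx Dvy eqW.
have D2 f : D (2 * f) = 2 * D f by rewrite !mulr_natl raddfMn.
have /(congr1 D) := eqW; rewrite D2.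
have DD f g : D (f + g) = D f + D g := raddfD D f g.
have DB f g : D (f - g) = D f - D g := raddfB D f g.
rewrite !(DM, DB, DD) Dx Dy Da Db Dr => DeqW.
set N := (X in _ = vx * vy * X) in eqW.
set DN := (X in _ = _ + vx * vy * X) in DeqW.
(* Up to the factor [vx * vy], this is [4 * x * y * (x - y) ^+ 2 * D W] once [W] and the derivatives
   of [vx], [vy] are eliminated. *)
have key : 2 * ((x - y) * ((y * (1 - a) - x * (1 - b)) * N + x * y * DN)
                - x * y * (a + b) * N) = 0.
  (* The cofactors of the four curve relations are the coefficients of [a * a], [b * b],
     [2 * a * a'] and [2 * b * b'] in the expanded left-hand side. *)
  transitivity (2 * y ^+ 3 * (2 * x - y) * (a * a -
      (1 + 2 * r * x + p2 * x ^+ 2 + p3 * x ^+ 3 + p4 * x ^+ 4))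
    + 2 * x ^+ 3 * (x - 2 * y) * (b * b -
      (1 + 2 * r * y + p2 * y ^+ 2 + p3 * y ^+ 3 + p4 * y ^+ 4))
    - x * y ^+ 3 * (x - y) * (2 * a * a' -
      (2 * r + 2 * p2 * x + 3 * p3 * x ^+ 2 + 4 * p4 * x ^+ 3))
    - x ^+ 3 * y * (x - y) * (2 * b * b' -
      (2 * r + 2 * p2 * y + 3 * p3 * y ^+ 2 + 4 * p4 * y ^+ 3))).
    by rewrite /N /DN; ring.
  by rewrite a2 b2 aa' bb' !subrr !mulr0 !subr0 addr0.
(* A combination of [DeqW] and [eqW] in which the terms containing [W] itself cancel. *)
transitivity (2 * x * y * (x - y) * (2 * ((a - - b) * W + (x - y) * D W))
              - 2 * x * y * (a + b) * (2 * ((x - y) * W))); first by ring.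
rewrite DeqW eqW -/N.
transitivity (2 * (x - y) * ((x * D vx) * vy * y + vx * (y * D vy) * x) * N
   + vx * vy * (2 * (x - y) * x * y * DN - 2 * x * y * (a + b) * N)); first by ring.
rewrite Dvx Dvy; transitivity (vx * vy * (2 * ((x - y) *
  ((y * (1 - a) - x * (1 - b)) * N + x * y * DN) - x * y * (a + b) * N))).
  by ring.
by rewrite key mulr0.
Qed.

(** * Invertible integers and square roots of quartics *)

Lemma natr_unit_fps {A : comUnitRingType} n :
  n%:R \is a @GRing.unit A -> n%:R \is a @GRing.unit {fps A}.
Proof. by move=> /(rmorph_unit (@fpsC A)); rewrite rmorph_nat. Qed.

Lemma natr_unit_Qp n : n.+1%:R \is a @GRing.unit Qp.
Proof.
rewrite -(rmorph_nat (@mpolyC 4 rat)); apply: rmorph_unit.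
by rewrite unitfE Num.Theory.pnatr_eq0.
Qed.

Lemma fps_unitE {A : comUnitRingType} (f : {fps A}) :
  (f \is a GRing.unit) = (f 0%N \is a GRing.unit).
Proof. by []. Qed.

Lemma deriv_sqr_quartic {A : comUnitRingType} (f : {fps A}) (q1 q2 q3 q4 : A) :
  f * f = 1 + fpsC q1 * fpsX + fpsC q2 * fpsX ^+ 2 + fpsC q3 * fpsX ^+ 3 +
    fpsC q4 * fpsX ^+ 4 ->
  2 * f * fps_deriv f = fpsC q1 + 2 * fpsC q2 * fpsX +
    3 * fpsC q3 * fpsX ^+ 2 + 4 * fpsC q4 * fpsX ^+ 3.
Proof.
have DD (g h : {fps A}) : fps_deriv (g + h) = fps_deriv g + fps_deriv h.
  exact: (raddfD (@fps_deriv A)).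
move=> /(congr1 (@fps_deriv A)).
rewrite !(DD, fps_derivM, fps_derivC) !fps_derivX => eqf.
transitivity (fps_deriv f * f + f * fps_deriv f); first by ring.
by rewrite eqf; ring.
Qed.

(** Comparison of constant terms. It trades p_1 for 2 R'(0), the form in which the linear
    coefficient enters [P2]. *)
Lemma fpsC_linear_coef {A : comUnitRingType} (f : {fps A}) (q1 q2 q3 q4 : A) :
  2 * f * fps_deriv f = fpsC q1 + 2 * fpsC q2 * fpsX +
    3 * fpsC q3 * fpsX ^+ 2 + 4 * fpsC q4 * fpsX ^+ 3 ->
  f 0%N = 1 -> fpsC q1 = 2 * fpsC (fps_deriv f 0%N).
Proof.
pose h : {rmorphism {fps A} -> A} := @fps_head A.
move=> /(congr1 h) eqf f0; rewrite -(rmorph_nat (@fpsC A) 2).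
rewrite -rmorphM; congr fpsC; symmetry.
have [hX hf] : h fpsX = 0 /\ h f = 1 by [].
rewrite !(rmorphD, rmorphXn, rmorphM, rmorph_nat) hX hf in eqf.
by rewrite mulr1 !expr0n !mulr0 !addr0 in eqf.
Qed.

(** * The argument of mu, its invariance under D, and the addition formula *)

Section AdditionFormula.
Context {A : comUnitRingType} {R B mu nu v : {fps A}} {q1 q2 q3 q4 : A}.
Hypothesis natr_unit : forall n, n.+1%:R \is a @GRing.unit A.
Hypotheses (R0 : R 0%N = 1) (B0 : B 0%N = 1) (muB : mu * B = fpsX).
Hypothesis sqrR : R * R = 1 + fpsC q1 * fpsX + fpsC q2 * fpsX ^+ 2 +
  fpsC q3 * fpsX ^+ 3 + fpsC q4 * fpsX ^+ 4.
Hypothesis eqB : B = fps_comp R mu / fps_deriv mu.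
Hypothesis inv_nu : comp_inverse mu nu.
Hypothesis vE : v = R * fps_deriv nu.

Local Notation r := (fpsC (fps_deriv R 0%N)).

Lemma deriv_mu0 : fps_deriv mu 0%N = 1.
Proof.
have [mu0 _ _ _] := inv_nu.
have := congr1 (@fps_deriv A) muB; rewrite fps_derivM fps_derivX.
move=> /(congr1 (fun f : {fps A} => f 0%N)); rewrite fpsDE !fpsM0 fps1E.
by rewrite mu0 B0 mulr1 mul0r addr0.
Qed.

Lemma deriv_mu_nu : fps_comp (fps_deriv mu) nu * fps_deriv nu = 1.
Proof.
have [mu0 nu0 mu_nu _] := inv_nu.
by rewrite -fps_deriv_comp // mu_nu fps_derivX.
Qed.

Lemma deriv_nu0 : fps_deriv nu 0%N = 1.
Proof.
have /(congr1 (fun f : {fps A} => f 0%N)) := deriv_mu_nu.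
by rewrite fpsM0 fps_comp0 deriv_mu0 mul1r.
Qed.

Lemma nu_ode : nu = fpsX * v.
Proof.
have [mu0 nu0 mu_nu _] := inv_nu.
have Bmu' : B * fps_deriv mu = fps_comp R mu.
  by rewrite {1}eqB divrK // fps_unitE deriv_mu0 unitr1.
(* Composing x mu' = mu R(mu) with nu gives nu mu'(nu) = x R; multiplication by nu' then removes
   mu'(nu). *)
have /(congr1 (fun f : {fps A} => fps_comp f nu)) :
    fpsX * fps_deriv mu = mu * fps_comp R mu by rewrite -Bmu' mulrA muB.
rewrite (fps_compM fpsX _ _ nu0) (fps_compM mu _ _ nu0) (fpsX_comp _ nu0).
rewrite (fps_compA _ _ _ mu0 nu0) mu_nu fps_compX => nu_R.
by rewrite vE mulrA -nu_R -mulrA deriv_mu_nu mulr1.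
Qed.

Lemma v0 : v 0%N = 1.
Proof. by rewrite vE fpsM0 deriv_nu0 R0 mulr1. Qed.

(** Inserting nu' = v + x v' into v = R nu' eliminates nu. The result supplies D v(x) and, up to
    sign, D v(y). *)
Lemma v_ode : fpsX * (R * fps_deriv v) = v * (1 - R).
Proof.
have nu' : fps_deriv nu = v + fpsX * fps_deriv v.
  by rewrite [in LHS]nu_ode fps_derivM fps_derivX mul1r.
have vE' : v = R * (v + fpsX * fps_deriv v) by rewrite -nu'.
by rewrite mulrBr mulr1 {2}vE'; ring.
Qed.

Lemma P1E : in_x nu * in_y R * in_y (fps_deriv nu) =
  in_x fpsX * in_x v * in_y v.
Proof. by rewrite -mulrA -(rmorphM (@in_y A)) -vE nu_ode (rmorphM (@in_x A)). Qed.

Context {P2 : {fps {fps A}}}.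
Hypothesis P2_def : P2 = - in_x nu *
  (in_y (fps_deriv nu) * in_y R * (in_y (fps_deriv R) - in_y r)
   + in_y R ^+ 2 * in_y (fps_deriv (fps_deriv nu))).

(** As v' = R' nu' + R nu'', the large factor of [P2] is R v' - R'(0) v taken at y; after
    multiplication by y, [v_ode] removes v'. *)
Lemma yP2E : in_y fpsX * P2 =
  - (in_x fpsX * in_x v * in_y v) * (1 - in_y R - in_y r * in_y fpsX).
Proof.
pose h : {rmorphism {fps A} -> {fps {fps A}}} := @in_y A.
have in_x_nu : in_x nu = in_x fpsX * in_x v by rewrite nu_ode rmorphM.
have v' : fps_deriv v =
    fps_deriv R * fps_deriv nu + R * fps_deriv (fps_deriv nu).
  by rewrite vE fps_derivM.
have := congr1 h v_ode; have := congr1 h vE.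
rewrite v' !(rmorphM, rmorphD, rmorphB, rmorph1) /= => eq_v eq_ode.
transitivity (- (in_x fpsX * in_x v) * (in_y fpsX * (in_y R * (in_y (fps_deriv R) *
   in_y (fps_deriv nu) + in_y R * in_y (fps_deriv (fps_deriv nu))))
   - in_y r * in_y fpsX * (in_y R * in_y (fps_deriv nu)))).
  by rewrite P2_def in_x_nu; ring.
by rewrite eq_ode -eq_v; ring.
Qed.

Lemma xP2E : in_x fpsX * swap P2 =
  - (in_y fpsX * in_y v * in_x v) * (1 - in_x R - in_x r * in_x fpsX).
Proof.
have := congr1 (@swap A) yP2E.
by rewrite !(rmorphM, rmorphB, rmorphN, rmorph1) /= !swap_in_x !swap_in_y.
Qed.

Lemma swap_P1E : swap (in_x nu * in_y R * in_y (fps_deriv nu)) =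
  in_y fpsX * in_y v * in_x v.
Proof. by rewrite P1E !rmorphM /= !swap_in_x !swap_in_y. Qed.

(** The series P_1 and P_3 are the same expression, so this notation also serves in the denominator
    of the quotient. *)
Local Notation P1 := (in_x nu * in_y R * in_y (fps_deriv nu)).
Local Notation is_quotient Q := (Q * (P1 - swap P1) = P2 - swap P2).

Lemma is_quotientE Q : (Q * (P1 - swap P1) = P2 - swap P2) =
  (Q * (in_x fpsX - in_y fpsX) * (in_x v * in_y v) = P2 - swap P2).
Proof. by rewrite swap_P1E P1E; congr (_ = _); ring. Qed.

(** The denominator is x - y times v(x) v(y), a unit with constant term 1. Antisymmetry of the
    numerator gives existence, cancellation of x - y uniqueness. *)
Lemma quotient_unique : exists! Q, is_quotient Q.
Proof.
have vv_unit : in_x v * in_y v \is a GRing.unit.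
  rewrite fps_unitE fpsM0 -[in_x v 0%N]/(fpsC (v 0%N)) v0 rmorph1 mul1r.
  by rewrite -[in_y v 0%N]/v fps_unitE v0 unitr1.
have [Q eqQ] := sub_swap_divisible P2.
exists (Q / (in_x v * in_y v)); split=> [|Q'].
  by rewrite is_quotientE mulrAC divrK.
rewrite is_quotientE -eqQ => eqQ'; apply: subXYM_I.
by rewrite mulrAC -eqQ' mulrK.
Qed.

Context {Q W : {fps {fps A}}}.
Hypothesis quoQ : is_quotient Q.
Hypothesis W_def : W = P1 + swap P1 + 2^-1 * in_x nu * in_y nu * Q.

Lemma argumentE : 2 * ((in_x fpsX - in_y fpsX) * W) = in_x v * in_y v *
  (in_x fpsX * in_x fpsX - in_y fpsX * in_y fpsX
   + in_x fpsX * in_x fpsX * in_y R - in_y fpsX * in_y fpsX * in_x R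
   + in_x r * (in_x fpsX * in_y fpsX * (in_x fpsX - in_y fpsX))).
Proof.
have unit2 : 2 \is a @GRing.unit {fps {fps A}}.
  exact/natr_unit_fps/natr_unit_fps/natr_unit.
have in_x_nu : in_x nu = in_x fpsX * in_x v by rewrite nu_ode rmorphM.
have in_y_nu : in_y nu = in_y fpsX * in_y v by rewrite nu_ode rmorphM.
have in_y_r : in_y r = in_x r by apply: fps2P => -[|i] [|j].
have := xP2E; have := yP2E; rewrite in_y_r => yP2 xP2.
have := quoQ; rewrite is_quotientE => eqQ.
rewrite W_def swap_P1E P1E in_x_nu in_y_nu.
(* Since nu(x) nu(y) = x y v(x) v(y), the series [Q] enters only through the product known from
   [eqQ]. *)
transitivity (2 * (in_x fpsX - in_y fpsX) *
    (in_x fpsX * in_x v * in_y v + in_y fpsX * in_y v * in_x v)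
   + (2 * 2^-1) * in_x fpsX * in_y fpsX *
     (Q * (in_x fpsX - in_y fpsX) * (in_x v * in_y v))).
  by set h := 2^-1; ring.
rewrite mulrV // eqQ.
transitivity (2 * (in_x fpsX - in_y fpsX) *
    (in_x fpsX * in_x v * in_y v + in_y fpsX * in_y v * in_x v)
  + (in_x fpsX * (in_y fpsX * P2) - in_y fpsX * (in_x fpsX * swap P2))).
  by ring.
by rewrite xP2 yP2; ring.
Qed.

(** At x = 0 both [P1] and the term with nu(x) vanish, whatever [Q] is; [swap P1] becomes y v(y)
    v(0). *)
Lemma argument_x0 : W 0%N = nu.
Proof.
have [_ nu0 _ _] := inv_nu.
pose h : {rmorphism {fps {fps A}} -> {fps A}} := @fps_head {fps A}.
have h_x f : h (in_x f) = fpsC (f 0%N) by [].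
have h_y f : h (in_y f) = f by [].
rewrite -[W 0%N]/(h W) W_def swap_P1E P1E !(rmorphM, rmorphD) !h_x !h_y.
rewrite nu0 v0 [fpsX 0%N]/= rmorph0 rmorph1 !(mul0r, mulr0, mulr1, add0r, addr0).
by rewrite nu_ode.
Qed.

Lemma argument_invariant : elliptic_deriv R W = 0.
Proof.
have der := deriv_sqr_quartic _ _ _ _ _ sqrR.
have q1E := fpsC_linear_coef _ _ _ _ _ der R0.
have der_x f : elliptic_deriv R (in_x f) = in_x R * in_x (fps_deriv f).
  by rewrite elliptic_deriv_in_x rmorphM.
have der_y f : elliptic_deriv R (in_y f) = - (in_y R * in_y (fps_deriv f)).
  by rewrite elliptic_deriv_in_y rmorphM.
have in_xC (c : A) : in_y (fpsC c) = in_x (fpsC c) by apply: fps2P => -[|i] [|j].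
have unit4 : 4 \is a @GRing.unit {fps {fps A}}.
  exact/natr_unit_fps/natr_unit_fps/natr_unit.
(* Both [in_x] and [in_y] are ring morphisms, so the one-variable relations are transported once for
   both. *)
have image (h : {rmorphism {fps A} -> {fps {fps A}}}) :
  [/\ h R * h R = 1 + 2 * h r * h fpsX + h (fpsC q2) * h fpsX ^+ 2 +
        h (fpsC q3) * h fpsX ^+ 3 + h (fpsC q4) * h fpsX ^+ 4,
      2 * h R * h (fps_deriv R) = 2 * h r + 2 * h (fpsC q2) * h fpsX +
        3 * h (fpsC q3) * h fpsX ^+ 2 + 4 * h (fpsC q4) * h fpsX ^+ 3 &
      h fpsX * (h R * h (fps_deriv v)) = h v * (1 - h R)].
  have := congr1 h v_ode; have := congr1 h der; have := congr1 h sqrR.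
  by rewrite q1E !(rmorph_nat, rmorphXn, rmorphN, rmorphD, rmorphM, rmorph1).
have [sqr_x sqr'_x ode_x] := image (@in_x A).
have := image (@in_y A); rewrite /= !in_xC => -[sqr_y sqr'_y ode_y].
have DW := elliptic_invariant (elliptic_deriv R) (in_x fpsX) (in_y fpsX)
  (in_x R) (in_y R) (in_x (fps_deriv R)) (in_y (fps_deriv R)) (in_x v) (in_y v)
  (in_x r) (in_x (fpsC q2)) (in_x (fpsC q3)) (in_x (fpsC q4)) W
  (elliptic_derivM R) sqr_x sqr_y sqr'_x sqr'_y.
rewrite /= !der_x !der_y !fps_derivX !fps_derivC !rmorph1 !rmorph0 !mulr1 mulr0
  mulrN ode_x ode_y in DW.
move: DW => /(_ erefl erefl erefl erefl erefl erefl erefl argumentE) DW.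
(* The factors x - y (twice), y, x and the unit 4 in the conclusion of [elliptic_invariant] are
   cancelled one by one. *)
apply: subXYM_I; apply: subXYM_I; apply: in_yXM_I; apply: in_xXM_I.
by apply: (mulrI unit4); rewrite !mul0r !mulr0 -[RHS]DW; ring.
Qed.

Lemma addition_formula :
  in_x (fps_int R^-1) + in_y (fps_int R^-1)
  = fps_comp2 (fps_int R^-1) (fps_comp2 mu W).
Proof.
have [mu0 nu0 mu_nu _] := inv_nu.
have unitR : R \is a GRing.unit by rewrite fps_unitE R0 unitr1.
have W00 : W 0%N 0%N = 0 by rewrite argument_x0.
(* On x = 0 the series G is mu(nu(y)) = y, so both sides of the formula restrict to the integral up
   to y. *)
have G0 : fps_comp2 mu W 0%N = fpsX by rewrite fps_comp2_x0 argument_x0.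
have G00 : fps_comp2 mu W 0%N 0%N = 0 by rewrite G0.
have invG : elliptic_deriv R (fps_comp2 mu W) = 0.
  by rewrite (elliptic_deriv_comp2 _ _ _ W00) argument_invariant mulr0.
set L := fps_int _.
have RL : R * fps_deriv L = 1 by rewrite fps_deriv_int // (divrr unitR).
apply/eqP; rewrite -subr_eq0; apply/eqP.
apply: (@elliptic_deriv_inj0 _ R) => //.
  (* By [RL], D sends the two integrals on the left to 1 and -1. *)
  rewrite raddfB raddfD /= elliptic_deriv_in_x elliptic_deriv_in_y.
  rewrite (elliptic_deriv_comp2 _ _ _ G00) invG mulr0 subr0.
  by rewrite RL (rmorph1 (@in_x A)) (rmorph1 (@in_y A)) subrr.
rewrite fpsBE fpsDE fps_comp2_x0 G0 fps_compX [in_x L _]/= rmorph0 add0r.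
by rewrite subrr.
Qed.

End AdditionFormula.

Theorem theorem1p4 (R B nu : {fps Qp}) :
  is_sqrt_quartic R ->
  is_calB R B ->
  comp_inverse (mu_of B) nu ->
  (exists! Q : {fps {fps Qp}}, is_quotient R nu Q) /\
  (forall Q : {fps {fps Qp}}, is_quotient R nu Q ->
     in_x (fps_int R^-1) + in_y (fps_int R^-1)
     = fps_comp2 (fps_int R^-1) (G_of R (mu_of B) nu Q)).
Proof.
move=> [R0 sqrR] [B0 eqB] inv_nu.
have muB : mu_of B * B = fpsX.
  by rewrite /mu_of divrK // fps_unitE B0 unitr1.
have {}sqrR : R * R = 1 + fpsC 'X_0 * fpsX + fpsC 'X_1 * fpsX ^+ 2 +
    fpsC 'X_2 * fpsX ^+ 3 + fpsC 'X_3 * fpsX ^+ 4.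
  rewrite -expr2 sqrR /quartic !big_ord_recl big_ord0 expr1 addr0 !addrA.
  (* The variable indices on the two sides are ordinals of equal value, built differently. *)
  by do !congr (_ + fpsC 'X__ * _); apply: val_inj.
split; first exact: (quotient_unique R0 B0 muB eqB inv_nu erefl).
move=> Q quoQ.
(* The three [erefl] identify [v], [P2] and [W] with their defining expressions. *)
exact: (addition_formula natr_unit_Qp R0 B0 muB sqrR eqB inv_nu erefl erefl quoQ erefl).
Qed.
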